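(* Let $J\subseteq\mathbb{R}$ be an interval, let $A,B\in\mathcal{H}_n(J)$, let $f$ be a continuous real-valued convex function on $J$, and let $\Phi:\mathcal{M}_n\to\mathcal{M}_m$ be a positive linear map. Suppose that either (i) $\Phi$ is unital, i.e. $\Phi(I_n)=I_m$, or (ii) $0\in J$, $f(0)\le 0$ and $0<\Phi(I_n)\le I_m$. Then $$\lambda\left(f\left(\frac{\Phi(A)+\Phi(B)}{2}\right)\right)\prec_w \lambda\left(\Phi\left(\int_0^1 f(tA+(1-t)B)\,dt\right)\right).$$
   Context: $\mathcal{M}_n$ is the algebra of $n\times n$ complex matrices, with identity $I_n$. $\mathcal{H}_n(J)$ is the set of Hermitian matrices in $\mathcal{M}_n$ whose spectra are contained in $J$. $f(A)$ is defined by the functional calculus. For Hermitian $A,B$, $A\le B$ means $B-A$ is positive semidefinite, and $A>0$ means $A$ is positive definite. A linear map $\Phi$ is positive if $\Phi(A)\ge 0$ whenever $A\ge 0$. For a Hermitian $A\in\mathcal{M}_m$, $\lambda(A)=(\lambda_1(A),\dots,\lambda_m(A))$ is the vector of eigenvalues of $A$ in decreasing order, counted with multiplicity. For Hermitian $A,B\in\mathcal{M}_m$, the weak majorization $\lambda(A)\prec_w\lambda(B)$ means $\sum_{j=1}^k\lambda_j(A)\le\sum_{j=1}^k\lambda_j(B)$ for every $k=1,\dots,m$. *)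

(* Defs.v *)
From HB Require Import structures.
From mathcomp Require Import all_boot all_order all_algebra.
From mathcomp Require Import complex.
From mathcomp Require Import all_classical all_reals all_analysis.

Set Implicit Arguments.
Unset Strict Implicit.
Unset Printing Implicit Defensive.

Import Order.TTheory GRing.Theory Num.Theory.
Import numFieldNormedType.Exports.

Local Open Scope classical_set_scope.
Local Open Scope ring_scope.
Local Open Scope complex_scope.
Local Open Scope sesquilinear_scope.

Definition spectrum_in (R : realType) (J : set R) (n : nat) (A : 'M[R[i]]_n) :=
  forall z : R[i], eigenvalue A z -> exists2 x : R, J x & z = x%:C.

Definition herm_in (R : realType) (J : set R) (n : nat) (A : 'M[R[i]]_n) :=
  A \is hermsymmx /\ spectrum_in J A.

Definition psdmx (R : realType) (n : nat) (A : 'M[R[i]]_n) :=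
  A \is hermsymmx /\
  forall u : 'cV[R[i]]_n, 0 <= (u ^t* *m A *m u) ord0 ord0.

Definition posdefmx (R : realType) (n : nat) (A : 'M[R[i]]_n) :=
  A \is hermsymmx /\
  forall u : 'cV[R[i]]_n, u != 0 -> 0 < (u ^t* *m A *m u) ord0 ord0.

Definition loewner_le (R : realType) (n : nat) (A B : 'M[R[i]]_n) :=
  psdmx (B - A).

Definition positive_map (R : realType) (n m : nat)
    (Phi : 'M[R[i]]_n -> 'M[R[i]]_m) :=
  forall A : 'M[R[i]]_n, psdmx A -> psdmx (Phi A).

(* Meaningful for Hermitian A = P^-1 D P, P unitary, D real diagonal: f is
   applied to the diagonal of D, so only the values of f on the spectrum of A
   are used (see mxfun_eigenvector). *)
Definition mxfun (R : realType) (n : nat) (f : R -> R) (A : 'M[R[i]]_n) :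
    'M[R[i]]_n :=
  invmx (spectralmx A)
    *m diag_mx (map_mx (fun z : R[i] => (f (complex.Re z))%:C) (spectral_diag A))
    *m spectralmx A.

(* Entrywise Lebesgue integral over [0, 1]. *)
Definition mxintegral01 (R : realType) (n : nat) (F : R -> 'M[R[i]]_n) :
    'M[R[i]]_n :=
  \matrix_(i < n, j < n)
    ((\int[lebesgue_measure]_(t in `[0%R, 1%R]) complex.Re (F t i j)) +i*
     (\int[lebesgue_measure]_(t in `[0%R, 1%R]) complex.Im (F t i j))).

(* Meaningful for Hermitian A, whose spectral_diag is real (see
   char_poly_eigvals for the multiplicities). *)
Definition eigvals (R : realType) (n : nat) (A : 'M[R[i]]_n) : n.-tuple R :=
  [tuple of sort >=%R [tuple complex.Re (spectral_diag A ord0 i) | i < n]].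

Definition weak_majorized (R : realType) (m : nat) (x y : m.-tuple R) :=
  forall k : nat, (1 <= k <= m)%N -> \sum_(j < k) x`_j <= \sum_(j < k) y`_j.

Lemma eigvals_sorted (R : realType) (n : nat) (A : 'M[R[i]]_n) :
  sorted >=%R (eigvals A).
Proof. by apply: sort_sorted => x y; exact: le_total. Qed.

Lemma spectral_diagE (R : realType) (n : nat) (A : 'M[R[i]]_n) (i : 'I_n) :
  A \is hermsymmx -> (complex.Re (spectral_diag A ord0 i))%:C = spectral_diag A ord0 i.
Proof.
move=> /hermitian_spectral_diag_real /mxOverP/(_ ord0 i).
by move=> /complex_realP[x ->].
Qed.

Lemma char_poly_eigvals (R : realType) (n : nat) (A : 'M[R[i]]_n) :
  A \is hermsymmx ->
  char_poly A = \prod_(x <- eigvals A) ('X - (x%:C)%:P).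
Proof.
move=> hA; have /hermitian_normalmx/orthomx_spectralP AE := hA.
have -> : \prod_(x <- eigvals A) ('X - (x%:C)%:P) =
    \prod_(i < n) ('X - (spectral_diag A ord0 i)%:P).
  rewrite (perm_big [tuple complex.Re (spectral_diag A ord0 i) | i < n]) /=; last first.
    by rewrite perm_sort.
  by rewrite big_map big_enum /=; apply: eq_bigr => i _; rewrite spectral_diagE.
have Pu := spectral_unit A; set P := spectralmx A in AE Pu.
set d := spectral_diag A in AE *.
have pP : map_mx polyC (invmx P) *m map_mx polyC P = 1%:M.
  by rewrite -map_mxM mulVmx // map_mx1.
transitivity (char_poly (diag_mx d)).
  rewrite /char_poly; have -> : char_poly_mx A =
      map_mx polyC (invmx P) *m char_poly_mx (diag_mx d) *m map_mx polyC P.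
    rewrite /char_poly_mx {1}AE mulmxBr mulmxBl !map_mxM; congr (_ - _).
    by rewrite scalar_mxC -mulmxA pP mulmx1.
  by rewrite !det_mulmx mulrAC -det_mulmx pP det1 mul1r.
rewrite char_poly_trig ?diag_mx_is_trig //.
by apply: eq_bigr => i _; rewrite mxE eqxx mulr1n.
Qed.

Lemma mxfun_eigenvector (R : realType) (n : nat) (f : R -> R)
    (A : 'M[R[i]]_n) (x : R) (v : 'rV[R[i]]_n) :
  A \is hermsymmx -> v *m A = x%:C *: v -> v *m mxfun f A = (f x)%:C *: v.
Proof.
move=> hA; have /hermitian_normalmx/orthomx_spectralP AE := hA.
have Pu := spectral_unit A; rewrite {1}AE /mxfun !mulmxA.
set w := v *m invmx _ => vA.
have {}vA : w *m diag_mx (spectral_diag A) = x%:C *: w.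
  by rewrite -[LHS](mulmxK Pu) vA -scalemxAl.
suff -> : w *m diag_mx (map_mx (fun z : R[i] => (f (complex.Re z))%:C)
            (spectral_diag A)) = (f x)%:C *: w.
  by rewrite -scalemxAl /w mulmxKV.
clearbody w; apply/rowP => j; move/rowP/(_ j): vA; rewrite !mul_mx_diag !mxE.
have [->|w0] := eqVneq (w 0 j) 0; first by rewrite !mul0r !mulr0.
by rewrite [x%:C * _]mulrC => /(mulfI w0) ->; rewrite [RHS]mulrC.
Qed.

(* Main.v *)
(* Fix an eigenbasis v_1, ..., v_m of C = (Phi A + Phi B) / 2 and put
   rho X = <Phi(X) v_j, v_j>, a positive functional on matrices. Expanding a
   Hermitian X over its spectral projections turns rho X and rho (f X) into
   finite weighted sums, so the scalar Jensen inequality gives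
   f (rho X) <= rho (f X); in case (ii) the missing mass 1 - rho I is put at 0.
   With X_t = t A + (1 - t) B, pairing t with 1 - t and using the convexity of f
   gives 2 f (rho C') <= rho (f X_t) + rho (f X_(1-t)), C' = (A + B) / 2, and
   integrating yields f (c_j) <= <Phi(int f(X_t)) v_j, v_j> for the eigenvalues
   c_j of C. Ky Fan's maximum principle concludes. *)
Require Import Defs.
From HB Require Import structures.
From mathcomp Require Import all_boot all_order all_algebra.
From mathcomp Require Import complex.
From mathcomp Require Import all_classical all_reals all_analysis.
From mathcomp Require Import perm ring lra zify.

Set Implicit Arguments.
Unset Strict Implicit.
Unset Printing Implicit Defensive.

Import Order.TTheory GRing.Theory Num.Theory.
Import numFieldNormedType.Exports.

Local Open Scope classical_set_scope.
Local Open Scope ring_scope.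
Local Open Scope complex_scope.
Local Open Scope sesquilinear_scope.

(** * Convexity on an interval and inequalities for weighted sums *)

Lemma convex_functionP (R : realType) (J : set R) (f : R -> R) :
  convex_function (J : set (convex_lmodType R^o)) f ->
  forall t x y, 0 <= t <= 1 -> J x -> J y ->
    f (t * x + (1 - t) * y) <= t * f x + (1 - t) * f y.
Proof.
move=> fJ t x y /andP[t0 t1] Jx Jy.
have t01 : Itv.spec (@Itv.num_sem R) (Itv.Real `[0%Z, 1%Z]) t.
  by rewrite /= /Itv.num_sem num_real /= in_itv /= t0 t1.
have := fJ (Itv.mk t01) x y (mem_set Jx) (mem_set Jy).
by rewrite !convRE.
Qed.

Lemma interval_conv (R : realType) (J : set R) :
  is_interval J ->
  forall t x y, 0 <= t <= 1 -> J x -> J y -> J (t * x + (1 - t) * y).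
Proof.
move=> itvJ t x y /andP[t0 t1] Jx Jy.
have [xy|/ltW yx] := leP x y.
  by apply: (itvJ x y) => //; apply/andP; split; nra.
by apply: (itvJ y x) => //; apply/andP; split; nra.
Qed.

(** Induction splitting off the first point: the tail weights, divided by their total [w'], again
    sum to 1, and two-point convexity joins the two parts. When [w'] is 0 every tail weight vanishes
    and the first weight is 1. *)
Lemma jensen_sum (R : realType) (J : set R) (f : R -> R) :
  is_interval J -> convex_function (J : set (convex_lmodType R^o)) f ->
  forall n (w x : 'I_n -> R),
    (forall i, 0 <= w i) -> (forall i, J (x i)) -> \sum_i w i = 1 ->
    J (\sum_i w i * x i) /\ f (\sum_i w i * x i) <= \sum_i w i * f (x i).
Proof.
move=> itvJ /convex_functionP fJ; elim=> [|n IHn] w x w0 Jx.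
  by rewrite big_ord0 => /esym/eqP; rewrite oner_eq0.
rewrite !big_ord_recl => w1; set w' := \sum_i w (lift _ i) in w1.
have w'0 : 0 <= w' by apply: sumr_ge0.
have [w'e|w'N0] := eqVneq w' 0.
  have wl i : w (lift ord0 i) = 0.
    have /psumr_eq0P -> // := w'e; by move=> j _; exact: w0.
  rewrite !big1 ?addr0; try by move=> i _; rewrite wl mul0r.
  by move: w1; rewrite w'e addr0 => ->; rewrite !mul1r.
have w'gt0 : 0 < w' by rewrite lt_neqAle eq_sym w'N0.
have [|||Jy fy] :=
  IHn (fun i => w (lift ord0 i) / w') (fun i => x (lift ord0 i)).
- by move=> i; rewrite divr_ge0.
- by move=> i; exact: Jx.
- by rewrite -mulr_suml divff.
have sumE (g : 'I_n -> R) : \sum_i w (lift ord0 i) * g i =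
    (1 - w ord0) * \sum_i w (lift ord0 i) / w' * g i.
  have -> : 1 - w ord0 = w' by rewrite -w1; ring.
  by rewrite mulr_sumr; apply: eq_bigr => i _; field.
have w001 : 0 <= w ord0 <= 1 by rewrite w0 -w1 lerDl w'0.
rewrite !sumE; split; first exact: interval_conv.
apply: le_trans (fJ _ _ _ w001 _ _) _ => //.
by rewrite lerD2l ler_wpM2l // subr_ge0; case/andP: w001.
Qed.

(** Compare [w] with the indicator of [i < k]. The difference is nonpositive for [i < k], where
    [x i] is at least [x k.-1], and nonnegative afterwards, where it is at most [x k.-1]. Replacing
    every [x i] by [x k.-1] therefore only increases the sum, and the result is 0 because both
    weights have total [k]. *)
Lemma weighted_sum_le_topk (R : realType) (m k : nat) (x : nat -> R)
    (w : 'I_m -> R) :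
  (0 < k <= m)%N -> (forall i j, (i <= j < m)%N -> x j <= x i) ->
  (forall i, 0 <= w i <= 1) -> \sum_i w i = k%:R ->
  \sum_i w i * x i <= \sum_(i < k) x i.
Proof.
move=> /andP[k0 km] xdec w01 wk.
rewrite (big_ord_widen _ x km) [leRHS]big_mkcond /=.
have kE : k%:R = \sum_(i < m) (if (i < k)%N then 1 else 0) :> R.
  rewrite -big_mkcond /= -(big_ord_widen _ (fun=> 1) km).
  by rewrite sumr_const card_ord.
rewrite -subr_le0 -sumrB; apply: (@le_trans _ _
    (\sum_(i < m) (w i - (if (i < k)%N then 1 else 0)) * x k.-1)); last first.
  by rewrite -mulr_suml sumrB wk -kE subrr mul0r.
apply: ler_sum => i _; have /andP[wi0 wi1] := w01 i.
case: ifPn => ik.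
  have : x k.-1 <= x i by apply: xdec; lia.
  by move=> ?; nra.
have : x i <= x k.-1 by apply: xdec; have := ltn_ord i; lia.
by move=> ?; nra.
Qed.

(** * Spectral decomposition and functional calculus of Hermitian matrices *)

Lemma hermP (R : realType) n (A : 'M[R[i]]_n) :
  reflect (A^t* = A) (A \is hermsymmx).
Proof.
by apply: (iffP (is_hermitianmxP _ _ _)); rewrite expr0 scale1r => /esym.
Qed.

Lemma trmxC_mul (R : realType) n p q
    (A : 'M[R[i]]_(n, p)) (B : 'M[R[i]]_(p, q)) :
  (A *m B)^t* = B^t* *m A^t*.
Proof. by rewrite trmx_mul map_mxM. Qed.

Definition eigval (R : realType) n (A : 'M[R[i]]_n) (i : 'I_n) : R :=
  complex.Re (spectral_diag A ord0 i).

(** Rank-one orthogonal projection attached to the i-th eigenvector; [spectralmx] stores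
    eigenvectors as rows, so the adjoint stands on the left. *)
Definition eigproj (R : realType) n (A : 'M[R[i]]_n) (i : 'I_n) : 'M[R[i]]_n :=
  (row i (spectralmx A))^t* *m row i (spectralmx A).

Lemma mxfunE (R : realType) n (f : R -> R) (A : 'M[R[i]]_n) :
  mxfun f A = \sum_i (f (eigval A i))%:C *: eigproj A i.
Proof.
rewrite /mxfun invmx_unitary ?spectral_unitarymx //.
apply/matrixP => a b; rewrite mul_mx_diag !mxE summxE.
by apply: eq_bigr => i _; rewrite !mxE big_ord1 !mxE mulrCA mulrA.
Qed.

Lemma mxfun_id (R : realType) n (A : 'M[R[i]]_n) :
  A \is hermsymmx -> mxfun id A = A.
Proof.
move=> hA; have /orthomx_spectralP {2}-> := hermitian_normalmx hA.
rewrite /mxfun; congr (_ *m diag_mx _ *m _); apply/rowP => i.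
by rewrite mxE spectral_diagE.
Qed.

Lemma mxfun_cst (R : realType) n (c : R) (A : 'M[R[i]]_n) :
  mxfun (fun=> c) A = c%:C%:M.
Proof.
rewrite /mxfun (_ : map_mx _ _ = const_mx c%:C); last first.
  by apply/rowP => i; rewrite !mxE.
rewrite diag_const_mx mul_mx_scalar -scalemxAl.
by rewrite mulVmx ?spectral_unit // scalemx1.
Qed.

Lemma herm_spectral_sum (R : realType) n (A : 'M[R[i]]_n) :
  A \is hermsymmx -> A = \sum_i (eigval A i)%:C *: eigproj A i.
Proof. by move=> hA; rewrite -[LHS]mxfun_id // mxfunE. Qed.

Lemma sum_eigproj (R : realType) n (A : 'M[R[i]]_n) : \sum_i eigproj A i = 1%:M.
Proof.
rewrite -[RHS](mxfun_cst 1 A) mxfunE; apply: eq_bigr => i _.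
by rewrite scale1r.
Qed.

Lemma eigproj_psd (R : realType) n (A : 'M[R[i]]_n) i : psdmx (eigproj A i).
Proof.
split; first by apply/hermP; rewrite /eigproj trmxC_mul trmxCK.
move=> u; rewrite /eigproj; set v := row i _.
have -> : u^t* *m (v^t* *m v) *m u = (v *m u)^t* *m (v *m u).
  by rewrite trmxC_mul !mulmxA.
by rewrite mxE big_ord1 !mxE mulrC mul_conjC_ge0.
Qed.

Lemma eigval_in (R : realType) n (J : set R) (A : 'M[R[i]]_n) i :
  herm_in J A -> J (eigval A i).
Proof.
move=> [hA sA].
set P := spectralmx A; have Pu : P \in unitmx := spectral_unit A.
have PA : P *m A = diag_mx (spectral_diag A) *m P.
  have /orthomx_spectralP {1}-> := hermitian_normalmx hA.
  by rewrite !mulmxA mulmxV // mul1mx.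
(* Row [i] of [P] is a left eigenvector; it is nonzero because [P] is invertible. *)
have eigA : eigenvalue A (spectral_diag A ord0 i).
  apply/eigenvalueP; exists (row i P).
    by rewrite -row_mul PA row_mul row_diag_mx -scalemxAl -rowE.
  apply/eqP => r0; have /(congr1 (row i)) := mulmxV Pu.
  rewrite row_mul r0 mul0mx => /rowP/(_ i); rewrite !mxE eqxx => /eqP.
  by rewrite eq_sym oner_eq0.
by have [x Jx Ax] := sA _ eigA; rewrite /eigval Ax.
Qed.

Lemma herm_real_sum (R : realType) n (I : finType) (c : I -> R)
    (P : I -> 'M[R[i]]_n) :
  (forall i, P i \is hermsymmx) -> \sum_i (c i)%:C *: P i \is hermsymmx.
Proof.
move=> hP; apply/hermP/matrixP => a b; rewrite !mxE !summxE rmorph_sum.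
apply: eq_bigr => i _; have /hermP/matrixP/(_ a b) := hP i.
by rewrite !mxE rmorphM => <-; congr (_ * _); exact: conjc_real.
Qed.

Lemma mxfun_herm (R : realType) n (f : R -> R) (A : 'M[R[i]]_n) :
  mxfun f A \is hermsymmx.
Proof.
by rewrite mxfunE; apply: herm_real_sum => i; case: (eigproj_psd A i).
Qed.

(** * Quadratic forms and Jensen's inequality for positive functionals *)

Definition quad (R : realType) n (v : 'rV[R[i]]_n) (A : 'M[R[i]]_n) : R :=
  complex.Re ((v *m A *m v^t*) ord0 ord0).

Lemma quad_sum (R : realType) n (I : finType) (v : 'rV[R[i]]_n) (c : I -> R)
    (P : I -> 'M[R[i]]_n) :
  quad v (\sum_i (c i)%:C *: P i) = \sum_i c i * quad v (P i).
Proof.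
rewrite /quad mulmx_sumr mulmx_suml summxE.
rewrite (raddf_sum (@complex.Re R : {additive Rcomplex R -> R})).
apply: eq_bigr => i _; rewrite -scalemxAr -scalemxAl mxE.
by case: (_ ord0 ord0) => a b /=; rewrite mul0r subr0.
Qed.

Lemma quad_psd (R : realType) n (v : 'rV[R[i]]_n) (A : 'M[R[i]]_n) :
  psdmx A -> 0 <= quad v A.
Proof.
move=> [_ /(_ (v^t*))]; rewrite trmxCK /quad.
by case: (_ ord0 ord0) => a b; rewrite lecE /= => /andP[].
Qed.

Lemma row_spectral_mxfun (R : realType) n (f : R -> R) (A : 'M[R[i]]_n) i :
  row i (spectralmx A) *m mxfun f A =
  (f (eigval A i))%:C *: row i (spectralmx A).
Proof.
rewrite /mxfun -row_mul !mulmxA mulmxV ?spectral_unit // mul1mx row_mul.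
by rewrite row_diag_mx -scalemxAl -rowE mxE.
Qed.

Lemma row_unitary_norm (R : realType) n (U : 'M[R[i]]_n) i :
  U \is unitarymx -> (row i U *m (row i U)^t*) ord0 ord0 = 1.
Proof.
move=> /unitarymxP/matrixP/(_ i i); rewrite !mxE eqxx => h; rewrite -[RHS]h.
by apply: eq_bigr => j _; rewrite !mxE.
Qed.

Lemma quad_spectral (R : realType) n (f : R -> R) (A : 'M[R[i]]_n) i :
  quad (row i (spectralmx A)) (mxfun f A) = f (eigval A i).
Proof.
rewrite /quad row_spectral_mxfun -scalemxAl mxE row_unitary_norm ?mulr1 //.
exact: spectral_unitarymx.
Qed.

(** Linearity over the reals only: [quad v] takes a real part and so does not commute with complex
    scalars. *)
Definition real_functional (R : realType) n (rho : 'M[R[i]]_n -> R) :=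
  forall (I : finType) (c : I -> R) (P : I -> 'M[R[i]]_n),
    rho (\sum_i (c i)%:C *: P i) = \sum_i c i * rho (P i).

(** Membership of [rho A] in [J] is part of the conclusion because the convexity of [f] is applied
    again at such points. *)
Lemma functional_jensen (R : realType) n (J : set R) (f : R -> R)
    (rho : 'M[R[i]]_n -> R) (A : 'M[R[i]]_n) :
  is_interval J -> convex_function (J : set (convex_lmodType R^o)) f ->
  real_functional rho -> (forall X, psdmx X -> 0 <= rho X) ->
  rho 1%:M = 1 \/ [/\ J 0, f 0 <= 0 & rho 1%:M <= 1] ->
  A \is hermsymmx -> (forall i, J (eigval A i)) ->
  J (rho A) /\ f (rho A) <= rho (mxfun f A).
Proof.
move=> itvJ fJ rhoL rho0 rho1 hA JA.
have rhoAE : rho A = \sum_i rho (eigproj A i) * eigval A i.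
  rewrite [in LHS](herm_spectral_sum hA) rhoL.
  by apply: eq_bigr => i _; rewrite mulrC.
have rhofE : rho (mxfun f A) = \sum_i rho (eigproj A i) * f (eigval A i).
  by rewrite mxfunE rhoL; apply: eq_bigr => i _; rewrite mulrC.
have w0 i : 0 <= rho (eigproj A i) by exact/rho0/eigproj_psd.
have wsum : \sum_i rho (eigproj A i) = rho 1%:M.
  rewrite -(sum_eigproj A).
  have -> : \sum_i eigproj A i = \sum_i (1 : R)%:C *: eigproj A i.
    by apply: eq_bigr => i _; rewrite scale1r.
  by rewrite (rhoL _ (fun=> 1)); under [RHS]eq_bigr do rewrite mul1r.
rewrite rhoAE rhofE; case: rho1 => [r1|[J0 f0 r1]].
  by apply: (jensen_sum itvJ fJ) => //; rewrite wsum.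
(* The missing mass [1 - rho 1] is put at the point [0]. *)
pose w := fun i : 'I_n.+1 =>
  if unlift ord0 i is Some j then rho (eigproj A j) else 1 - rho 1%:M.
pose x := fun i : 'I_n.+1 => if unlift ord0 i is Some j then eigval A j else 0.
have [|||Jx fx] := @jensen_sum _ _ f itvJ fJ _ w x.
- by move=> i; rewrite /w; case: unliftP => // _; rewrite subr_ge0.
- by move=> i; rewrite /x; case: unliftP.
- rewrite big_ord_recl /w unlift_none.
  by under eq_bigr do rewrite liftK; rewrite wsum subrK.
have sE (g : R -> R) : \sum_i w i * g (x i) =
    (1 - rho 1%:M) * g 0 + \sum_i rho (eigproj A i) * g (eigval A i).
  rewrite big_ord_recl /w /x unlift_none; congr (_ + _).
  by apply: eq_bigr => i _; rewrite liftK.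
move: Jx fx; rewrite sE (sE id) mulr0 add0r; split => //.
by apply: le_trans fx _; rewrite gerDr mulr_ge0_le0 // subr_ge0.
Qed.

Lemma quad_functional (R : realType) n (v : 'rV[R[i]]_n) :
  real_functional (quad v).
Proof. by move=> I c P; rewrite quad_sum. Qed.

Lemma real_functional2 (R : realType) n (rho : 'M[R[i]]_n -> R) a b X Y :
  real_functional rho -> rho (a%:C *: X + b%:C *: Y) = a * rho X + b * rho Y.
Proof.
move=> rhoL.
have := rhoL bool (fun i => if i then a else b) (fun i => if i then X else Y).
by rewrite !big_bool.
Qed.

Lemma quad1 (R : realType) n (U : 'M[R[i]]_n) i :
  U \is unitarymx -> quad (row i U) 1%:M = 1.
Proof. by move=> Uu; rewrite /quad mulmx1 row_unitary_norm. Qed.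

Lemma quad_in (R : realType) n (J : set R) (A U : 'M[R[i]]_n) i :
  is_interval J -> A \is hermsymmx -> (forall i, J (eigval A i)) ->
  U \is unitarymx -> J (quad (row i U) A).
Proof.
move=> itvJ hA JA Uu.
(* The zero function serves as a dummy convex function: only the membership half of
   [functional_jensen] is wanted. *)
have c0 : convex_function (J : set (convex_lmodType R^o)) (fun=> 0 : R^o).
  by move=> t x y _ _; rewrite convRE !mulr0 addr0.
have [] // :=
  functional_jensen itvJ c0 (@quad_functional _ _ (row i U)) _ _ hA JA.
  by move=> X; exact: quad_psd.
by left; exact: quad1.
Qed.

Lemma eigval_segment (R : realType) n (J : set R) (A B : 'M[R[i]]_n) (t : R) :
  is_interval J ->
  A \is hermsymmx -> (forall i, J (eigval A i)) ->
  B \is hermsymmx -> (forall i, J (eigval B i)) -> 0 <= t <= 1 ->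
  let X := t%:C *: A + (1 - t)%:C *: B in
  X \is hermsymmx /\ forall i, J (eigval X i).
Proof.
move=> itvJ hA JA hB JB t01 X.
have hX : X \is hermsymmx.
  have := @herm_real_sum R n bool (fun i => if i then t else 1 - t)
    (fun i => if i then A else B).
  by rewrite big_bool; apply; case.
(* An eigenvalue of [X] is its quadratic form at a unit eigenvector, hence a convex combination of
   the forms of [A] and [B] there, both of which lie in [J]. *)
split => // i; rewrite -(quad_spectral id) mxfun_id //.
rewrite real_functional2; last exact: quad_functional.
by apply: interval_conv => //; apply: quad_in => //; exact: spectral_unitarymx.
Qed.

(** * Sorted eigenvalues and Ky Fan's maximum principle *)

Lemma sort_ge_perm (R : realType) m (d : 'I_m -> R) :
  exists s : 'S_m, forall i : 'I_m,
    (sort >=%R [tuple d i | i < m])`_i = d (s i).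
Proof.
have /tuple_permP[s sE] :
    perm_eq (sort >=%R [tuple d i | i < m]) [tuple d i | i < m].
  by rewrite perm_sort.
exists s => i; rewrite sE -(tnth_nth _ _ i) tnth_mktuple.
by rewrite tnth_map tnth_ord_tuple.
Qed.

Lemma sort_ge_nonincreasing (R : realType) m (d : 'I_m -> R) i j :
  (i <= j < m)%N ->
  (sort >=%R [tuple d i | i < m])`_j <= (sort >=%R [tuple d i | i < m])`_i.
Proof.
move=> /andP[ij jm].
have tr : transitive (>=%R : rel R).
  by move=> x y z xy yz; apply: le_trans yz xy.
apply: (sorted_leq_nth tr) => //; last 2 first.
- by rewrite inE size_sort size_tuple; apply: leq_ltn_trans jm.
- by rewrite inE size_sort size_tuple.
- by move=> x; exact: lexx.
- by apply: sort_sorted => x y; exact: le_total.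
Qed.

Lemma row_row_perm (R : Type) m n (s : 'S_m) (A : 'M[R]_(m, n)) i :
  row i (row_perm s A) = row (s i) A.
Proof. by apply/rowP => j; rewrite !mxE. Qed.

Lemma row_perm_unitary (R : realType) m (s : 'S_m) (V : 'M[R[i]]_m) :
  V \is unitarymx -> row_perm s V \is unitarymx.
Proof.
move=> /row_unitarymxP Vu; apply/row_unitarymxP => i j.
by rewrite !row_row_perm Vu (inj_eq perm_inj).
Qed.

(** The summands are the diagonal entries of [V *m P *m V^t*], which has the same trace as [P]. *)
Lemma quad_trace (R : realType) m (V P : 'M[R[i]]_m) :
  V \is unitarymx -> \sum_j quad (row j V) P = complex.Re (\tr P).
Proof.
move=> Vu.
have -> : \tr P = \tr (V *m P *m V^t*).
  rewrite mxtrace_mulC mulmxA -invmx_unitary // mulVmx ?mul1mx //.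
  exact: unitarymx_unit.
rewrite /mxtrace (raddf_sum (@complex.Re R : {additive Rcomplex R -> R})).
apply: eq_bigr => j _; congr complex.Re; rewrite -row_mul !mxE.
by apply: eq_bigr => l _; rewrite !mxE.
Qed.

Lemma eigproj_trace (R : realType) m (A : 'M[R[i]]_m) i : \tr (eigproj A i) = 1.
Proof.
rewrite /eigproj mxtrace_mulC /mxtrace big_ord1 row_unitary_norm //.
exact: spectral_unitarymx.
Qed.

Lemma ky_fan (R : realType) m k (f : R -> R) (A V : 'M[R[i]]_m) :
  (0 < k <= m)%N -> V \is unitarymx ->
  \sum_(j < m | (j < k)%N) quad (row j V) (mxfun f A) <=
  \sum_(j < k) (sort >=%R [tuple f (eigval A i) | i < m])`_j.
Proof.
move=> k0m Vu; have [s sE] := sort_ge_perm (fun i => f (eigval A i)).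
(* Weight that the first [k] rows of [V] put on the i-th eigenprojection. It is at most 1, since the
   sum over all rows is the trace of a rank-one projection; the total is [k], since the
   eigenprojections sum to the identity and the rows are unit vectors. *)
pose w i := \sum_(j < m | (j < k)%N) quad (row j V) (eigproj A i).
have q0 j i : 0 <= quad (row j V) (eigproj A i) by exact/quad_psd/eigproj_psd.
have -> : \sum_(j < m | (j < k)%N) quad (row j V) (mxfun f A) =
          \sum_i w (s i) * (sort >=%R [tuple f (eigval A i) | i < m])`_i.
  transitivity (\sum_i w i * f (eigval A i)); last first.
    by rewrite (reindex_inj (@perm_inj _ s)); apply: eq_bigr => i _; rewrite sE.
  rewrite /w.
  under [RHS]eq_bigr do rewrite mulr_suml.
  rewrite exchange_big /=; apply: eq_bigr => j _.
  by rewrite mxfunE quad_sum; apply: eq_bigr => i _; rewrite mulrC.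
apply: weighted_sum_le_topk => //.
- by move=> i j; exact: sort_ge_nonincreasing.
- move=> i; rewrite sumr_ge0 //=.
  apply: (@le_trans _ _ (\sum_j quad (row j V) (eigproj A (s i)))).
    by rewrite [leRHS](bigID (fun j : 'I_m => (j < k)%N)) /= lerDl sumr_ge0.
  by rewrite quad_trace // eigproj_trace.
- transitivity (\sum_i w i).
    by rewrite [RHS](reindex_inj (@perm_inj _ s)).
  rewrite exchange_big /=.
  have -> : k%:R = \sum_(j < m | (j < k)%N) 1 :> R.
    case/andP: k0m => _ km; rewrite -(big_ord_widen _ (fun=> 1) km).
    by rewrite sumr_const card_ord.
  apply: eq_bigr => j _; rewrite -(quad1 j Vu) -(sum_eigproj A).
  have -> : \sum_i eigproj A i = \sum_i (1 : R)%:C *: eigproj A i.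
    by apply: eq_bigr => i _; rewrite scale1r.
  by rewrite quad_sum; apply: eq_bigr => i _; rewrite mul1r.
Qed.

Lemma weak_majorized_mxfun (R : realType) m (f : R -> R) (A Z : 'M[R[i]]_m) :
  Z \is hermsymmx ->
  (forall j, f (eigval A j) <= quad (row j (spectralmx A)) Z) ->
  weak_majorized (eigvals (mxfun f A)) (eigvals Z).
Proof.
move=> hZ fZ k /[dup] k0m /andP[_ km]; set Y := mxfun f A.
have [s sE] := sort_ge_perm (eigval Y).
have [s' s'E] := sort_ge_perm (fun i => f (eigval A i)).
(* The eigenbasis chosen for [f(A)] may differ from that of [A]. A first use of [ky_fan], on the
   sorted eigenbasis of [Y], bounds the top eigenvalues of [Y] by the top values of
   [f (eigval A i)]; a second one, on the eigenbasis of [A] reordered by [s'], passes to [Z]. *)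
rewrite [leLHS](_ : _ = \sum_(j < m | (j < k)%N)
    quad (row j (row_perm s (spectralmx Y))) Y); last first.
  rewrite (big_ord_widen _ (fun j => (eigvals Y)`_j) km); apply: eq_bigr => j _.
  rewrite row_row_perm -[X in quad _ X]mxfun_id; last exact: mxfun_herm.
  by rewrite quad_spectral -sE.
apply: le_trans (ky_fan f A k0m _) _.
  exact/row_perm_unitary/spectral_unitarymx.
have := @ky_fan _ _ k id Z (row_perm s' (spectralmx A)) k0m.
rewrite mxfun_id // => /(_ (row_perm_unitary _ (spectral_unitarymx _))).
apply: le_trans; rewrite (big_ord_widen _ (nth 0 _) km).
by apply: ler_sum => j _; rewrite s'E row_row_perm.
Qed.

(** * Continuity of the functional calculus along a segment *)

Lemma finite_hull (R : realType) (I : finType) (J : set R) (x : I -> R) :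
  I -> (forall i, J (x i)) ->
  exists a b, [/\ J a, J b & forall i, a <= x i <= b].
Proof.
move=> i0 Jx.
exists (x [arg min_(i < i0) x i]%O), (x [arg max_(i > i0) x i]%O).
split=> // i.
case: arg_minP => // j _ /(_ i isT) xj; case: arg_maxP => // k _ /(_ i isT) xk.
exact/andP.
Qed.

(** Within distance [d] of [x], continuity gives the term [e]; farther away the difference is at
    most [2 * M'], with [M'] a bound of [f] on the segment, and [L = 2 * M' / d] absorbs it. A bound
    affine in the distance is the form that [mxfun_perturbation] can transfer to matrices. *)
Lemma continuous_linear_modulus (R : realType) (a b : R) (f : R -> R) :
  {within `[a, b], continuous f} -> forall x e, `[a, b]%classic x -> 0 < e ->
  exists2 L, 0 <= L &
    forall y, `[a, b]%classic y -> `|f x - f y| <= e + L * `|x - y|.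
Proof.
move=> fc x e xab e0.
have [M [_ fM]] :=
  compact_bounded (continuous_compact fc (@segment_compact R a b)).
have {fM} [M' M'0 fM] :
    exists2 M, 0 <= M & forall y, `[a, b]%classic y -> `|f y| <= M.
  exists (`|M| + 1) => // y yab.
  apply: (fM (`|M| + 1)); last by exists y.
  by rewrite (le_lt_trans (ler_norm _)) // ltrDl.
have /subspace_continuousP/(_ x xab)/cvgrPdist_le/(_ e e0) := fc.
rewrite near_withinE => /nbhs_ballP[d /= d0 fd].
exists (2 * M' / d) => [|y yab].
  by apply: divr_ge0; [exact: mulr_ge0|exact: ltW].
have [xy|xy] := ltP `|x - y| d.
  have := fd y; rewrite /ball /= => /(_ xy yab) fe.
  by rewrite (le_trans fe) // lerDl !mulr_ge0 // invr_ge0 ltW.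
rewrite (le_trans (ler_normB _ _)) //.
rewrite (le_trans (lerD (fM _ xab) (fM _ yab))) //.
rewrite -[leLHS]add0r; apply: lerD; first exact: ltW.
have -> : 2 * M' / d * `|x - y| = 2 * M' * (`|x - y| / d) by ring.
have : 1 <= `|x - y| / d by rewrite ler_pdivlMr // mul1r.
by move=> h; nra.
Qed.

Lemma unitary_entry_le1 (R : realType) n (U : 'M[R[i]]_n) i j :
  U \is unitarymx -> `|U i j| <= 1.
Proof.
move=> Uu; rewrite -(@expr_le1 _ 2) // normCK.
rewrite -(row_unitary_norm i Uu) mxE (bigD1 j) //= !mxE lerDl.
rewrite sumr_ge0 // => k _.
by rewrite !mxE mul_conjC_ge0.
Qed.

Lemma mulmx_entry_le (K : numDomainType) n p q r (P : 'M[K]_(n, p))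
    (M : 'M[K]_(p, q)) (Q : 'M[K]_(q, r)) i j :
  (forall k, `|P i k| <= 1) -> (forall k, `|Q k j| <= 1) ->
  `|(P *m M *m Q) i j| <= \sum_k \sum_l `|M k l|.
Proof.
move=> P1 Q1; rewrite mxE (le_trans (ler_norm_sum _ _ _)) // exchange_big /=.
apply: ler_sum => l _; rewrite normrM.
apply: (@le_trans _ _ `|(P *m M) i l|); first by rewrite ler_piMr.
rewrite mxE (le_trans (ler_norm_sum _ _ _)) //.
by apply: ler_sum => k _; rewrite normrM ler_piMl.
Qed.

Lemma spectralmx_mxfun (R : realType) n (f : R -> R) (X : 'M[R[i]]_n) :
  spectralmx X *m mxfun f X =
  diag_mx (\row_i (f (eigval X i))%:C) *m spectralmx X.
Proof.
rewrite /mxfun !mulmxA mulmxV ?spectral_unit // mul1mx.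
by congr (diag_mx _ *m _); apply/rowP => i; rewrite !mxE.
Qed.

Lemma mxfun_spectralmx (R : realType) n (f : R -> R) (X : 'M[R[i]]_n) :
  mxfun f X *m (spectralmx X)^t* =
  (spectralmx X)^t* *m diag_mx (\row_i (f (eigval X i))%:C).
Proof.
rewrite /mxfun -invmx_unitary ?spectral_unitarymx // -!mulmxA.
by rewrite mulmxV ?spectral_unit // mulmx1; congr (_ *m diag_mx _);
  apply/rowP => i; rewrite !mxE.
Qed.

(* In the eigenbases of [X] and [Y] the matrices of [f X - f Y] and of [X - Y]
   are the Schur products of one unitary matrix with [f x_i - f y_j] and with
   [x_i - y_j], so that scalar estimates transfer entrywise. *)
Lemma mxfun_perturbation (R : realType) n (f : R -> R) (X Y : 'M[R[i]]_n) e L :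
  X \is hermsymmx -> Y \is hermsymmx -> 0 <= e -> 0 <= L ->
  (forall i j, `|f (eigval X i) - f (eigval Y j)| <=
               e + L * `|eigval X i - eigval Y j|) ->
  forall k l, `|(mxfun f X - mxfun f Y) k l| <=
    \sum_(i < n) \sum_(j < n)
      (e%:C + L%:C * \sum_(k < n) \sum_(l < n) `|(X - Y) k l|).
Proof.
move=> hX hY e0 L0 fXY k l.
set U := spectralmx X; set V := spectralmx Y.
have Uu : U \is unitarymx := spectral_unitarymx X.
have Vu : V \is unitarymx := spectral_unitarymx Y.
have U1 i j : `|U i j| <= 1 by exact: unitary_entry_le1.
have V1 i j : `|V i j| <= 1 by exact: unitary_entry_le1.
have Ut1 i j : `|U^t* i j| <= 1 by rewrite !mxE norm_conjC.
have Vt1 i j : `|V^t* i j| <= 1 by rewrite !mxE norm_conjC.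
have T1 i j : `|(U *m V^t*) i j| <= 1.
  by apply: unitary_entry_le1; rewrite mul_unitarymx ?trmxC_unitary.
have GE g i j : (U *m (mxfun g X - mxfun g Y) *m V^t*) i j =
    (g (eigval X i) - g (eigval Y j))%:C * (U *m V^t*) i j.
  rewrite mulmxBr mulmxBl spectralmx_mxfun -[U *m mxfun g Y *m _]mulmxA.
  rewrite mxfun_spectralmx mulmxA -[diag_mx _ *m U *m _]mulmxA.
  rewrite mul_diag_mx mul_mx_diag !mxE rmorphB mulrBl.
  by congr (_ - _); rewrite mulrC.
have -> : mxfun f X - mxfun f Y =
    U^t* *m (U *m (mxfun f X - mxfun f Y) *m V^t*) *m V.
  rewrite !mulmxA -!invmx_unitary // mulVmx ?unitarymx_unit // mul1mx.
  by rewrite mulmxKV // unitarymx_unit.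
apply: le_trans (mulmx_entry_le _ _ _) _ => //.
apply: ler_sum => i _; apply: ler_sum => j _.
apply: (@le_trans _ _ (e%:C + L%:C * `|(U *m (X - Y) *m V^t*) i j|));
  last by rewrite lerD2l ler_wpM2l ?ler0c //; apply: mulmx_entry_le.
have := GE id i j; rewrite !mxfun_id // => ->; rewrite GE !normrM.
have nC (x : R) : `|x%:C| = `|x|%:C
  by rewrite normc_def /= expr0n addr0 sqrtr_sqr.
rewrite !nC; set T := `|(U *m V^t*) i j|.
have T0 : 0 <= T by exact: normr_ge0.
apply: (@le_trans _ _ ((e + L * `|eigval X i - eigval Y j|)%:C * T)).
  by rewrite ler_wpM2r // lecR.
(* [T <= 1] is spent on the [e] term only; in the [L] term the factor [T] is kept, being part of the
   entry of [X - Y]. *)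
rewrite rmorphD rmorphM mulrDl mulrA lerD2r.
have eC : 0 <= e%:C by rewrite ler0c.
exact: (ler_piMr eC (T1 i j)).
Qed.

Lemma Re_Im_le_norm (R : realType) (z : R[i]) (e : R) :
  `|z| <= e%:C -> `|complex.Re z| <= e /\ `|complex.Im z| <= e.
Proof.
rewrite normc_def lecR => ze; split; apply: le_trans ze;
  rewrite -sqrtr_sqr ler_wsqrtr //.
  by rewrite lerDl sqr_ge0.
by rewrite lerDr sqr_ge0.
Qed.

(** The denominator has [c + 1] instead of [c] so that [c = 0] needs no separate case. *)
Lemma mul_half_ratio_le (R : realType) (c e : R) :
  0 <= c -> 0 < e -> c * (e / (2 * (c + 1))) <= e / 2.
Proof.
move=> c0 e0; have c1 : 0 < c + 1 by rewrite ltr_wpDl.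
have -> : c * (e / (2 * (c + 1))) = e / 2 * (c / (c + 1)).
  by field; rewrite lt0r_neq0.
rewrite ler_piMr ?divr_ge0 ?(ltW e0) //.
by rewrite ler_pdivrMr // mul1r lerDl.
Qed.

Lemma mxfun_segment_near (R : realType) n (a b : R) (f : R -> R)
    (A B : 'M[R[i]]_n) (t0 e : R) k l :
  {within `[a, b], continuous f} ->
  A \is hermsymmx -> (forall i, `[a, b]%classic (eigval A i)) ->
  B \is hermsymmx -> (forall i, `[a, b]%classic (eigval B i)) ->
  let X t := t%:C *: A + (1 - t)%:C *: B in
  `[0, 1]%classic t0 -> 0 < e ->
  \forall t \near within `[0, 1]%classic (nbhs t0),
    `|mxfun f (X t0) k l - mxfun f (X t) k l| <= e%:C.
Proof.
move=> fc hA Aab hB Bab X t01 e0.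
have XP t : `[0, 1]%classic t ->
    X t \is hermsymmx /\ forall i, `[a, b]%classic (eigval (X t) i).
  move=> /=; rewrite in_itv /= => t01'.
  exact: (eigval_segment (@interval_is_interval _ `[a, b]) hA Aab hB Bab t01').
(* [N] is the square of [n], the number of terms in the perturbation bound; [d] is chosen so that
   [N * d] is at most [e / 2]. *)
pose N : R := \sum_(i < n) \sum_(j < n) 1.
have N0 : 0 <= N by apply: sumr_ge0 => i _; apply: sumr_ge0.
pose d := e / (2 * (N + 1)).
have d0 : 0 < d by rewrite divr_gt0 // mulr_gt0 // ltr_wpDl.
have [hX0 X0ab] := XP _ t01.
have /choice[L LP] : forall i, exists L, 0 <= L /\
    forall y, `[a, b]%classic y ->
      `|f (eigval (X t0) i) - f y| <= d + L * `|eigval (X t0) i - y|.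
  move=> i; have [L L0 Lf] := continuous_linear_modulus fc (X0ab i) d0.
  by exists L.
(* Each eigenvalue of the fixed [X t0] has its own slope; their sum dominates them all,
   independently of the moving eigenvalues of [X t]. *)
pose L' := \sum_i L i.
have L'0 : 0 <= L' by apply: sumr_ge0 => i _; case: (LP i).
have LL' i : L i <= L'.
  by rewrite /L' (bigD1 i) //= lerDl sumr_ge0 // => j _; case: (LP j).
pose K := \sum_(i < n) \sum_(j < n) `|(A - B) i j|.
have K0 : 0 <= K by apply: sumr_ge0 => i _; apply: sumr_ge0.
have KE : K = (complex.Re K)%:C by rewrite RRe_real // ger0_real.
have K'0 : 0 <= complex.Re K by rewrite -ler0c -KE.
pose c := N * L' * complex.Re K.
have c0 : 0 <= c by rewrite !mulr_ge0.
near=> t.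
have [hX Xab] : X t \is hermsymmx /\ forall i, `[a, b]%classic (eigval (X t) i).
  by apply: XP; near: t; exact: withinT.
have fX i j : `|f (eigval (X t0) i) - f (eigval (X t) j)| <=
    d + L' * `|eigval (X t0) i - eigval (X t) j|.
  have [_ /(_ _ (Xab j)) h] := LP i; apply: le_trans h _.
  by rewrite lerD2l ler_wpM2r.
have := mxfun_perturbation hX0 hX (ltW d0) L'0 fX k l; rewrite !mxE => h.
apply: le_trans h _.
(* [X t0 - X t] equals [(t0 - t)] times [A - B], so its entry sum is linear in the distance of the
   parameters. *)
have XE : \sum_(k < n) \sum_(l < n) `|(X t0 - X t) k l| =
    (`|t0 - t| * complex.Re K)%:C.
  rewrite rmorphM /= -KE /K mulr_sumr; apply: eq_bigr => i _.
  rewrite mulr_sumr; apply: eq_bigr => j _.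
  have -> : (X t0 - X t) i j = (t0 - t)%:C * (A - B) i j.
    by rewrite !mxE !rmorphB /=; ring.
  by rewrite normrM; congr (_ * _); rewrite normc_def /= expr0n addr0 sqrtr_sqr.
rewrite XE -rmorphM -rmorphD /=.
have -> : \sum_(i < n) \sum_(j < n) (d + L' * (`|t0 - t| * complex.Re K))%:C =
   (N * (d + L' * (`|t0 - t| * complex.Re K)))%:C.
  by rewrite /N !sumr_const !mulrnAl mul1r !rmorphMn.
rewrite lecR.
have -> : N * (d + L' * (`|t0 - t| * complex.Re K)) = N * d + c * `|t0 - t|.
  by rewrite /c; ring.
rewrite [leRHS](splitr e) lerD //; first exact: mul_half_ratio_le.
apply: (@le_trans _ _ (c * (e / (2 * (c + 1))))).
  rewrite ler_wpM2l //; near: t.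
  apply: cvg_within; apply/nbhs_ballP; exists (e / (2 * (c + 1))) => /=.
    by rewrite divr_gt0 // mulr_gt0 // ltr_wpDl.
  by move=> t /= /ltW.
exact: mul_half_ratio_le.
Unshelve. all: by end_near.
Qed.

Lemma mxfun_segment_continuous (R : realType) n (a b : R) (f : R -> R)
    (A B : 'M[R[i]]_n) k l :
  {within `[a, b], continuous f} ->
  A \is hermsymmx -> (forall i, `[a, b]%classic (eigval A i)) ->
  B \is hermsymmx -> (forall i, `[a, b]%classic (eigval B i)) ->
  let X t := t%:C *: A + (1 - t)%:C *: B in
  {within `[0, 1], continuous (fun t => complex.Re (mxfun f (X t) k l))} /\
  {within `[0, 1], continuous (fun t => complex.Im (mxfun f (X t) k l))}.
Proof.
move=> fc hA Aab hB Bab X.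
have ReB (z w : R[i]) : complex.Re (z - w) = complex.Re z - complex.Re w
  by case: z; case: w.
have ImB (z w : R[i]) : complex.Im (z - w) = complex.Im z - complex.Im w
  by case: z; case: w.
split; apply/subspace_continuousP => t0 t01; apply/cvgrPdist_le => e e0;
  have := mxfun_segment_near k l fc hA Aab hB Bab t01 e0;
  by apply: filterS => t /Re_Im_le_norm[]; rewrite ?ReB ?ImB.
Qed.

(** * Entrywise integrals, real functionals and Hermitian images *)

Lemma Rintegral_sum_finType (R : realType) (I : finType) (D : set R)
    (h : I -> R -> R) (r : I -> R) (mu := @lebesgue_measure R) :
  measurable D -> (forall p, mu.-integrable D (EFin \o h p)) ->
  mu.-integrable D (EFin \o (fun t => \sum_p h p t * r p)) /\
  \int[mu]_(t in D) (\sum_p h p t * r p) =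
  \sum_p (\int[mu]_(t in D) h p t) * r p.
Proof.
move=> mD hi.
have hri p : mu.-integrable D (EFin \o (fun t => h p t * r p)).
  rewrite (_ : _ \o _ = (fun t => (EFin \o h p) t * (r p)%:E)%E); last first.
    by apply/funext => t /=; rewrite EFinM.
  exact: integrableZr.
elim: (index_enum I) => [|p s [IHi IHe]].
  under eq_fun do rewrite big_nil.
  rewrite big_nil; split; first exact: integrable0.
  by rewrite Rintegral_cst // mul0r.
under eq_fun do rewrite big_cons.
split; last by rewrite big_cons RintegralD // IHe RintegralZr.
rewrite (_ : _ \o _ = (fun t => (EFin \o (fun t => h p t * r p)%R) t +
   (EFin \o (fun t => \sum_(i <- s) h i t * r i)%R) t)%E); last first.
  by apply/funext => t /=; rewrite EFinD.
exact: integrableD.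
Qed.

(** Expansion in the real basis formed by the matrix units and their multiples by ['i]; its
    coordinates are exactly the functions integrated in [mxintegral01]. *)
Lemma mx_Re_Im_sum (R : realType) n (M : 'M[R[i]]_n) :
  M = \sum_(p : 'I_n * 'I_n * bool)
    (if p.2 then complex.Re (M p.1.1 p.1.2)
     else complex.Im (M p.1.1 p.1.2))%:C *:
    ((if p.2 then 1 else 'i%C) *: delta_mx p.1.1 p.1.2).
Proof.
rewrite {1}(matrix_sum_delta M) pair_big /= -(pair_big xpredT xpredT (fun p b =>
  (if b then complex.Re (M p.1 p.2) else complex.Im (M p.1 p.2))%:C *:
  ((if b then 1 else 'i%C) *: delta_mx p.1 p.2))) /=.
apply: eq_bigr => -[k l] _; rewrite big_bool /= !scalerA -scalerDl mulr1.
by rewrite [in LHS](complexE (M k l)) [_%:C * 'i%C]mulrC.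
Qed.

(** [rho] is a fixed finite real combination of the real and imaginary parts of the entries, each
    continuous on a compact segment and hence integrable, so it commutes with the integral. *)
Lemma mxintegral01_functional (R : realType) n (F : R -> 'M[R[i]]_n)
    (rho : 'M[R[i]]_n -> R) (mu := @lebesgue_measure R) :
  real_functional rho ->
  (forall k l, {within `[0, 1], continuous (fun t => complex.Re (F t k l))}) ->
  (forall k l, {within `[0, 1], continuous (fun t => complex.Im (F t k l))}) ->
  mu.-integrable `[0, 1] (EFin \o (fun t => rho (F t))) /\
  rho (mxintegral01 F) = \int[mu]_(t in `[0, 1]) rho (F t).
Proof.
move=> rhoL cRe cIm.
have rhoE M : rho M = \sum_(p : 'I_n * 'I_n * bool)
    (if p.2 then complex.Re (M p.1.1 p.1.2) else complex.Im (M p.1.1 p.1.2)) *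
    rho ((if p.2 then 1 else 'i%C) *: delta_mx p.1.1 p.1.2).
  by rewrite {1}(mx_Re_Im_sum M) rhoL.
have ci (h : R -> R) : {within `[0, 1], continuous h} ->
    mu.-integrable `[0, 1] (EFin \o h).
  by apply: continuous_compact_integrable; exact: segment_compact.
have [|] := @Rintegral_sum_finType R ('I_n * 'I_n * bool)%type `[0, 1]%classic
  (fun p t => if p.2 then complex.Re (F t p.1.1 p.1.2)
              else complex.Im (F t p.1.1 p.1.2))
  (fun p => rho ((if p.2 then 1 else 'i%C) *: delta_mx p.1.1 p.1.2))
    (measurable_itv _).
  by case=> [[k l] []] /=; apply: ci.
move=> ii ie.
have -> : (fun t => rho (F t)) = _ := funext (fun t => rhoE (F t)).
split=> //; rewrite rhoE ie; by apply: eq_bigr => -[[k l] []] _ /=; rewrite mxE.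
Qed.

Lemma mxintegral01_herm (R : realType) n (F : R -> 'M[R[i]]_n) :
  (forall k l, {within `[0, 1], continuous (fun t => complex.Im (F t k l))}) ->
  (forall t, F t \is hermsymmx) -> mxintegral01 F \is hermsymmx.
Proof.
move=> cIm hF; apply/hermP/matrixP => k l; rewrite !mxE.
have FE t : F t k l = (F t l k)^*.
  by have /hermP/matrixP/(_ k l) := hF t; rewrite !mxE => <-.
rewrite /Num.conj /=; congr (_ +i* _).
  by apply: eq_Rintegral => t _; rewrite FE; case: (F t l k).
rewrite -mulN1r -RintegralZl //; last first.
  by apply: continuous_compact_integrable; [exact: segment_compact|exact: cIm].
by apply: eq_Rintegral => t _; rewrite FE mulN1r; case: (F t l k).
Qed.

(** Positivity speaks of semidefinite matrices only; a Hermitian matrix is a real combination of its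
    eigenprojections, whose images are Hermitian. *)
Lemma positive_map_herm (R : realType) n m
    (Phi : {linear 'M[R[i]]_n -> 'M[R[i]]_m}) (A : 'M[R[i]]_n) :
  positive_map Phi -> A \is hermsymmx -> Phi A \is hermsymmx.
Proof.
move=> Phi0 /herm_spectral_sum ->; rewrite linear_sum.
under eq_bigr do rewrite linearZ.
by apply: herm_real_sum => i; have [] := Phi0 _ (eigproj_psd A i).
Qed.

Lemma mxintegral01_onem (R : realType) n (F : R -> 'M[R[i]]_n) :
  (forall k l, {within `[0, 1], continuous (fun t => complex.Re (F t k l))}) ->
  (forall k l, {within `[0, 1], continuous (fun t => complex.Im (F t k l))}) ->
  mxintegral01 F = mxintegral01 (fun t => F (1 - t)).
Proof.
move=> cRe cIm; apply/matrixP => k l; rewrite !mxE; congr (_ +i* _).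
  by rewrite Rintegration_by_substitution_onem ?ler01 ?lexx // unstable.onem1.
by rewrite Rintegration_by_substitution_onem ?ler01 ?lexx // unstable.onem1.
Qed.

(** * The Hermite-Hadamard inequality for positive functionals *)

Lemma functional_hermite_hadamard (R : realType) n (J : set R) (f : R -> R)
    (A B : 'M[R[i]]_n) (rho : 'M[R[i]]_n -> R) :
  is_interval J -> convex_function (J : set (convex_lmodType R^o)) f ->
  real_functional rho -> (forall X, psdmx X -> 0 <= rho X) ->
  rho 1%:M = 1 \/ [/\ J 0, f 0 <= 0 & rho 1%:M <= 1] ->
  A \is hermsymmx -> (forall i, J (eigval A i)) ->
  B \is hermsymmx -> (forall i, J (eigval B i)) ->
  let F t := mxfun f (t%:C *: A + (1 - t)%:C *: B) in
  (forall k l, {within `[0, 1], continuous (fun t => complex.Re (F t k l))}) ->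
  (forall k l, {within `[0, 1], continuous (fun t => complex.Im (F t k l))}) ->
  (forall k l, {within `[0, 1], continuous
     (fun t => complex.Re (F (1 - t) k l))}) ->
  (forall k l, {within `[0, 1], continuous
     (fun t => complex.Im (F (1 - t) k l))}) ->
  f ((rho A + rho B) / 2) <= rho (mxintegral01 F).
Proof.
move=> itvJ fJ rhoL rho0 rho1 hA JA hB JB F cRe cIm cRe' cIm'.
have XP t : 0 <= t <= 1 -> let x := t * rho A + (1 - t) * rho B in
    J x /\ f x <= rho (F t).
  move=> t01; have [hX JX] := eigval_segment itvJ hA JA hB JB t01.
  have := functional_jensen itvJ fJ rhoL rho0 rho1 hX JX.
  by rewrite real_functional2.
clearbody F; have [iF rF] := mxintegral01_functional rhoL cRe cIm.
have [iF' rF'] := mxintegral01_functional rhoL cRe' cIm'.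
set c := f _.
(* The integral is unchanged by the reflection of [t] to [1 - t], so twice its value is the sum of
   both forms. *)
suff : 2 * c <= rho (mxintegral01 F) + rho (mxintegral01 (fun t => F (1 - t))).
  rewrite -mxintegral01_onem //; clearbody c.
  by move: (rho (mxintegral01 F)) => y; lra.
rewrite rF rF' -RintegralD //.
have mu01 : fine (lebesgue_measure (`[0, 1]%classic : set R)) = 1.
  by rewrite lebesgue_measure_itv /= lte_fin ltr01 sube0.
have -> : 2 * c = \int[lebesgue_measure]_(t in `[0, 1]) (2 * c).
  by rewrite Rintegral_cst // mu01 mulr1.
apply: le_Rintegral => //.
- rewrite (_ : _ \o _ = fun=> (2 * c)%:E) //.
  by apply: (continuous_compact_integrable (f := fun=> 2 * c));
    [exact: segment_compact|move=> ?; exact: cvg_cst].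
- rewrite (_ : _ \o _ = ((EFin \o (fun t => rho (F t))%R) \+
                          (EFin \o (fun t => rho (F (1 - t)))%R))%E) //.
  exact: integrableD.
move=> t /=; rewrite in_itv /= => t01.
have t01' : 0 <= 1 - t <= 1 by lra.
have [Jx fx] := XP _ t01; have [Jy fy] := XP _ t01'.
have h01 : 0 <= (2^-1 : R) <= 1 by lra.
have := convex_functionP fJ h01 Jx Jy.
(* The points at parameters [t] and [1 - t] have the same midpoint for every [t]. *)
have -> : 2^-1 * (t * rho A + (1 - t) * rho B) +
    (1 - 2^-1) * ((1 - t) * rho A + (1 - (1 - t)) * rho B) =
    (rho A + rho B) / 2.
  by field.
rewrite -/c; lra.
Qed.

(** * Transfer to the eigenbasis of [(Phi A + Phi B) / 2] *)

Theorem theorem3p3 (R : realType) (n m : nat) (J : set R)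
    (A B : 'M[R[i]]_n) (f : R -> R)
    (Phi : {linear 'M[R[i]]_n -> 'M[R[i]]_m}) :
  is_interval J ->
  herm_in J A -> herm_in J B ->
  {within J, continuous f} ->
  convex_function (J : set (convex_lmodType R^o)) f ->
  positive_map Phi ->
  (Phi 1%:M = 1%:M \/
   [/\ J 0, f 0 <= 0, posdefmx (Phi 1%:M) & loewner_le (Phi 1%:M) 1%:M]) ->
  weak_majorized
    (eigvals (mxfun f (2^-1 *: (Phi A + Phi B))))
    (eigvals (Phi (mxintegral01
       (fun t : R => mxfun f (t%:C *: A + (1 - t)%:C *: B))))).
Proof.
move=> itvJ [hA sA] [hB sB] fc fJ Phi0 Phi1 k /[dup] k0m /andP[k0 km].
have JA i : J (eigval A i) by exact: eigval_in.
have JB i : J (eigval B i) by exact: eigval_in.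
have j0 : 'I_m by exact: (Ordinal (leq_trans k0 km)).
(* If [n = 0] then [Phi 1%:M] is 0, which contradicts both unitality and positive definiteness since
   [m] is positive. *)
have i0 : 'I_n.
  case: n A B Phi hA sA hB sB Phi0 Phi1 {JA JB} => [A B Phi _ _ _ _ _|n *];
    last exact: ord0.
  have -> : Phi 1%:M = 0 by rewrite (flatmx0 1%:M) linear0.
  move=> Phi1; exfalso; case: Phi1 => [/matrixP/(_ j0 j0)|[_ _ [_ +] _]].
    by rewrite !mxE eqxx => /eqP; rewrite eq_sym oner_eq0.
  have u0 : const_mx 1 != 0 :> 'cV[R[i]]_m.
    by apply/eqP => /matrixP/(_ j0 ord0)/eqP; rewrite !mxE oner_eq0.
  by move=> /(_ _ u0); rewrite mulmx0 mul0mx mxE ltxx.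
(* [J] need not be compact: a segment inside it holding the eigenvalues of both [A] and [B] (told
   apart by the Boolean) makes [f] bounded where it is used. *)
have [a [b [Ja Jb ab]]] := finite_hull (x := fun p : 'I_n * bool =>
  if p.2 then eigval A p.1 else eigval B p.1) (i0, true)
  (fun p => match p with (i, true) => JA i | (i, false) => JB i end).
have Aab i : `[a, b]%classic (eigval A i).
  by rewrite /= in_itv; exact: (ab (i, true)).
have Bab i : `[a, b]%classic (eigval B i).
  by rewrite /= in_itv; exact: (ab (i, false)).
have fab : {within `[a, b], continuous f}.
  by apply: continuous_subspaceW fc => x /=; rewrite in_itv; exact: itvJ.
pose F (t : R) := mxfun f (t%:C *: A + (1 - t)%:C *: B); rewrite -/F.
have cF k' l := mxfun_segment_continuous k' l fab hA Aab hB Bab.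
(* Exchanging [A] and [B] reverses the segment, which gives the continuity of [F (1 - t)]. *)
have cF' k' l := mxfun_segment_continuous k' l fab hB Bab hA Aab.
have FE t : F (1 - t) = mxfun f (t%:C *: B + (1 - t)%:C *: A).
  by rewrite /F subKr addrC.
set C := 2^-1 *: _.
have CE : C = (2^-1 : R)%:C *: Phi A + (2^-1 : R)%:C *: Phi B.
  by rewrite /C scalerDr fmorphV rmorph_nat.
have hC : C \is hermsymmx.
  have := @herm_real_sum R m bool (fun=> 2^-1)
    (fun i => if i then Phi A else Phi B).
  by rewrite big_bool CE; apply; case; exact: positive_map_herm.
apply: weak_majorized_mxfun => //.
  apply: positive_map_herm => //; apply: mxintegral01_herm => [k' l|t].
    by have [] := cF k' l.
  exact: mxfun_herm.
move=> j; set v := row j _.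
have vu : quad v 1%:M = 1 by apply: quad1; exact: spectral_unitarymx.
pose rho X := quad v (Phi X).
have rhoL : real_functional rho.
  move=> I c P; rewrite /rho linear_sum; under eq_bigr do rewrite linearZ.
  by rewrite quad_sum.
have -> : eigval C j = (rho A + rho B) / 2.
  rewrite -(quad_spectral id) mxfun_id // {2}CE real_functional2;
    last exact: quad_functional.
  by rewrite -mulrDr mulrC.
apply: (@functional_hermite_hadamard _ _ J f A B rho) => //.
- by move=> X /Phi0; exact: quad_psd.
- case: Phi1 => [Phi1|[J0 f0 _ le1]]; first by left; rewrite /rho Phi1.
  (* Since [v] is a unit vector, the form of [1%:M - Phi 1%:M] at [v] is [1 - rho 1%:M], nonnegative
     by the Loewner bound. *)
  right; split => //; rewrite /rho.
  have := quad_psd v le1.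
  have -> : 1%:M - Phi 1%:M = (1 : R)%:C *: 1%:M + (-1 : R)%:C *: Phi 1%:M.
    by rewrite rmorphN scale1r scaleN1r.
  rewrite real_functional2; last exact: quad_functional.
  by rewrite vu; lra.
- by move=> k' l; have [] := cF k' l.
- by move=> k' l; have [] := cF k' l.
- move=> k' l; have [+ _] := cF' k' l; apply: subspace_eq_continuous => t _ /=.
  by rewrite /from_subspace -FE.
- move=> k' l; have [_ +] := cF' k' l; apply: subspace_eq_continuous => t _ /=.
  by rewrite /from_subspace -FE.
Qed.
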